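(* For every integer $c>1$ with $c\ne 2$ and $c\neq 4$, and every integer $n\ge 2$, $$\frac{n!}{2\binom{n}{2}}\le M(n,\overline{c\mathbb{N}}),$$ where $\overline{c\mathbb{N}}$ denotes the set of natural numbers not divisible by $c$.
   Context: $K_n$ is the complete graph on the vertex set $\{1,\dots,n\}$. Hamiltonian paths of $K_n$ are undirected and are regarded as (labelled) subgraphs of $K_n$. For a set $\mathbb{D}\subseteq\mathbb{N}$, two Hamiltonian paths in $K_n$ are called $\mathbb{D}$-cycle different if the union of the two paths (the graph whose edge set is the union of their edge sets) contains a cycle, not necessarily induced, whose length belongs to $\mathbb{D}$. $M(n,\mathbb{D})$ denotes the largest cardinality of a set of Hamiltonian paths in $K_n$ any two distinct members of which are $\mathbb{D}$-cycle different. *)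

(* Defs.v *)
From HB Require Import structures.
From mathcomp Require Import all_boot all_order all_algebra.

Set Implicit Arguments.
Unset Strict Implicit.
Unset Printing Implicit Defensive.

(* The vertex set of K_n is 'I_n; a subgraph of K_n is its set of edges, an
   edge being an unordered pair [set x; y] with x != y.  A Hamiltonian path is
   its edge set, so that a vertex sequence and its reversal give the same path. *)

Definition path_edges (n : nat) (s : seq 'I_n) : {set {set 'I_n}} :=
  [set [set p.1; p.2] | p in zip s (behead s)].

Definition ham_path (n : nat) (E : {set {set 'I_n}}) : bool :=
  [exists s : n.-tuple 'I_n, uniq s && (E == path_edges s)].

Definition adj (n : nat) (E : {set {set 'I_n}}) : rel 'I_n :=
  fun x y => [set x; y] \in E.

(* The cycles are not required to be induced. *)
Definition has_cycle (n : nat) (E : {set {set 'I_n}}) (k : nat) : bool :=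
  (2 < k) && [exists c : k.-tuple 'I_n, ucycleb (adj E) c].

(* A cycle in a graph on n vertices has length at most n, so the bound on k is
   harmless. *)
Definition cycle_different (n : nat) (D : pred nat)
    (E F : {set {set 'I_n}}) : bool :=
  [exists k : 'I_n.+1, D k && has_cycle (E :|: F) k].

Definition pairwise_cycle_different (n : nat) (D : pred nat)
    (P : {set {set {set 'I_n}}}) : bool :=
  [forall E in P, ham_path E] &&
  [forall E in P, forall F in P, (E != F) ==> cycle_different D E F].

Definition M (n : nat) (D : pred nat) : nat :=
  \max_(P : {set {set {set 'I_n}}} | pairwise_cycle_different D P) #|P|.

Definition nonmultiples (c : nat) : pred nat := fun k => ~~ (c %| k).

(* Main.v *)
Require Import Defs.
From HB Require Import structures.
From mathcomp Require Import all_boot all_order all_algebra.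

Set Implicit Arguments.
Unset Strict Implicit.
Unset Printing Implicit Defensive.

Import Order.TTheory GRing.Theory Num.Theory.
Local Open Scope ring_scope.

(** The bound equals [(n - 2)!], the number of Hamiltonian paths with two
    prescribed endpoints.  All of these are pairwise cycle different, so they
    form the required family.

    To see this, take two different paths from [x0] to [y0] through the same
    vertices and drop their common beginning, so that they leave a common
    vertex [x] towards different vertices, the first one along
    [x = s_0, y = s_1, s_2, ...] and the second one towards [z = s_j] with
    [j >= 2].  The second path does not end in [y], hence gives [y] two
    neighbours.  Neither of them is [x], whose only neighbour in what is left
    of the second path is [z], and at most one of them is [s_2]; so there is a
    neighbour [s_k] with [k >= 3].  The chords [x s_j] and [y s_k] of the first
    path close the cycles [s_0 .. s_j] of length [j + 1] and [s_1 .. s_k] of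
    length [k], and together with the edge [x y] a third cycle, of length
    [|j - k| + 3], through the segment of the path between [s_j] and [s_k].  If
    [c] divided all three lengths, it would divide
    [(j + 1) + (k - j + 3) - k = 4] when [j <= k], and
    [k + (j - k + 3) - (j + 1) = 2] when [k <= j]; but [c] is none of 1, 2, 4.

    The combinatorial core is [two_chords_cycle], the reduction to it is
    [paths_same_ends_cycle], and [path_edges_inj] ensures that the family has
    as many members as there are orderings of the inner vertices. *)

(** * Two paths with the same endpoints close a suitable cycle *)

Section Cycles.

Variables (T : eqType) (e : rel T) (c : nat).
Hypothesis e_sym : symmetric e.

Definition good_cycle (C : seq T) : Prop :=
  [/\ 2 < size C, ucycle e C & ~~ (c %| size C)]%N.

Lemma closed_path_ucycle x p :
  path e x p -> uniq (x :: p) -> e x (last x p) -> ucycle e (x :: p).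
Proof. by move=> ep up ex; rewrite /ucycle /= rcons_path ep e_sym ex. Qed.

Lemma good_cycle3 C1 C2 C3 :
  (2 < size C1)%N -> (2 < size C2)%N -> (2 < size C3)%N ->
  ucycle e C1 -> ucycle e C2 -> ucycle e C3 ->
  ~~ [&& c %| size C1, c %| size C2 & c %| size C3]%N ->
  exists C, good_cycle C.
Proof.
move=> s1 s2 s3 u1 u2 u3; rewrite !negb_and => /or3P[] nd.
- by exists C1.
- by exists C2.
- by exists C3.
Qed.

Hypotheses (c_gt1 : (1 < c)%N) (c_neq2 : c != 2%N) (c_neq4 : c != 4%N).

Lemma ndvd2 : ~~ (c %| 2)%N.
Proof. by apply/negP => /dvdn_leq -/(_ isT); rewrite leq_eqVlt (negPf c_neq2) ltnNge c_gt1. Qed.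

Lemma ndvd4 : ~~ (c %| 4)%N.
Proof.
apply/negP => dv; have := dvdn_leq (isT : 0 < 4)%N dv.
by case: c c_gt1 c_neq2 c_neq4 dv => [|[|[|[|[|]]]]].
Qed.

(** The path ends at the far end [w := last z r] of the second chord, so that the
    two chords cross, or share an end when [r] is empty.  The cycles [C1] and
    [C2] closed by one chord each and [C3] through both chords satisfy
    [size C1 + size C3 = size C2 + 4]. *)
Lemma crossing_chords_cycle x y s z r :
  path e x (y :: s ++ z :: r) -> uniq (x :: y :: s ++ z :: r) ->
  e x z -> e y (last z r) -> (0 < size s + size r)%N ->
  exists C, good_cycle C.
Proof.
rewrite /= !inE !mem_cat !cat_uniq cat_path /= !inE.
move=> /and3P[exy ps /andP[eszl pr]] /and3P[+ + /and4P[us + zr ur]].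
rewrite !negb_or => /and4P[xy xs xz xr] /and3P[ys yz yr] /andP[zs rs].
move=> exz eyw gt0.
have ryxzr : path e y [:: x, z & r] by rewrite /= e_sym exy exz.
apply: (@good_cycle3 (x :: y :: rcons s z) (y :: s ++ z :: r) [:: y, x, z & r]).
- by rewrite /= size_rcons.
- by rewrite /= size_cat addnS.
- by [].
- apply: closed_path_ucycle; rewrite /= ?last_rcons //.
    by rewrite rcons_path exy ps.
  by rewrite !inE !mem_rcons rcons_uniq !inE !negb_or xy xs xz ys yz us zs.
- apply: closed_path_ucycle; rewrite /= ?last_cat /= //.
    by rewrite cat_path ps /= eszl.
  by rewrite mem_cat cat_uniq /= inE !negb_or ys yz yr us zs rs zr.
- apply: closed_path_ucycle => //.
  by rewrite /= !inE !negb_or [y == x]eq_sym xy yz yr xz xr zr.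
apply/negP; rewrite /= size_rcons size_cat /= => /and3P[d1 d2 d3].
case/negP: ndvd4; rewrite -(dvdn_addr 4 d2).
have -> : ((size s + (size r).+1).+1 + 4 = (size s).+3 + (size r).+3)%N.
  by rewrite !(addnS, addSn) addn0.
exact: dvdn_add.
Qed.

(** The path ends at the far end [z := last w r] of the first chord, so that the
    chord from [y] is nested in the chord from [x].  Now the lengths satisfy
    [size C2 + size C3 = size C1 + 2]. *)
Lemma nested_chords_cycle x y s w r :
  path e x (y :: s ++ w :: r) -> uniq (x :: y :: s ++ w :: r) ->
  e x (last w r) -> e y w -> (0 < size s)%N ->
  exists C, good_cycle C.
Proof.
rewrite /= !inE !mem_cat !cat_uniq cat_path /= !inE.
move=> /and3P[exy ps /andP[eswl pr]] /and3P[+ + /and4P[us + wr ur]].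
rewrite !negb_or => /and4P[xy xs xw xr] /and3P[ys yw yr] /andP[ws rs].
move=> exz eyw gt0.
apply: (@good_cycle3 (x :: y :: s ++ w :: r) (y :: rcons s w) [:: x, y, w & r]).
- by rewrite /= size_cat addnS.
- by rewrite /= size_rcons ltnS.
- by [].
- apply: closed_path_ucycle; rewrite /= ?last_cat /= //.
    by rewrite exy cat_path ps /= eswl.
  rewrite !inE !mem_cat cat_uniq /= !inE !negb_or xy xs xw xr ys yw yr us.
  by rewrite ws rs wr.
- apply: closed_path_ucycle; rewrite /= ?last_rcons //.
    by rewrite rcons_path ps.
  by rewrite mem_rcons rcons_uniq inE negb_or ys yw us ws.
- apply: closed_path_ucycle; rewrite /= //.
    by rewrite exy eyw.
  by rewrite !inE !negb_or xy xw xr yw yr wr.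
apply/negP; rewrite /= size_rcons size_cat /= => /and3P[d1 d2 d3].
case/negP: ndvd2; rewrite -(dvdn_addr 2 d1).
have -> : ((size s + (size r).+1).+2 + 2 = (size s).+2 + (size r).+3)%N.
  by rewrite !(addnS, addSn) addn0.
exact: dvdn_add.
Qed.

(** Cutting the path behind the later of the two far ends leaves one of the two
    previous situations.  The vertex [w] must not follow [y] immediately, since
    [y w] would then be an edge of the path instead of a chord. *)
Lemma two_chords_cycle x y s z w :
  path e x (y :: s) -> uniq (x :: y :: s) -> z \in s -> w \in s ->
  e x z -> e y w -> w != head y s -> exists C, good_cycle C.
Proof.
have prefix a b : path e x (y :: a ++ b) -> uniq (x :: y :: a ++ b) ->
    path e x (y :: a) /\ uniq (x :: y :: a).
  by rewrite -!cat_cons cat_path cat_uniq => /andP[-> _] /andP[-> _].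
move=> ps us zs; case/splitPr: zs ps us => s1 s2 ps us.
rewrite mem_cat => /orP[ws1|ws2] exz eyw hw.
  case/splitPr: ws1 ps us hw => u v.
  have -> : (u ++ w :: v) ++ z :: s2 = (u ++ w :: rcons v z) ++ s2.
    by rewrite -!catA /= cat_rcons.
  move=> /prefix h /h[pu uu] hw.
  apply: nested_chords_cycle pu uu _ eyw _; first by rewrite last_rcons.
  by case: u hw {h} => //=; rewrite eqxx.
move: ws2 ps us hw eyw; case/splitPl: s2 / => r s3 <-.
have -> : s1 ++ z :: r ++ s3 = (s1 ++ z :: r) ++ s3 by rewrite -catA.
move=> /prefix h /h[pr ur] hw eyw.
apply: crossing_chords_cycle pr ur exz eyw _.
by case: s1 r hw {h} => [|? ?] [|? ?] //=; rewrite eqxx.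
Qed.

(** At the first vertex [x] where the two paths separate, [t] continues along a
    chord of [s] from [x], and one of the two neighbours in [t] of the next
    vertex [y] of [s] is the end of a chord from [y]. *)
Lemma paths_same_ends_cycle x s t :
  path e x s -> path e x t -> uniq (x :: s) -> uniq (x :: t) ->
  perm_eq s t -> last x s = last x t -> s != t -> exists C, good_cycle C.
Proof.
elim: s x t => [|y s IHs] x [|z t]; rewrite ?eqxx //.
- by move=> _ _ _ _ /perm_size.
- by move=> _ _ _ _ /perm_size.
have [<- | yz] := eqVneq y z.
  move=> /andP[_ ps] /andP[_ pt] /andP[_ us] /andP[_ ut].
  rewrite perm_cons => st lst.
  rewrite eqseq_cons eqxx; exact: IHs ps pt us ut st lst.
move=> ps pt us ut /perm_mem st /= lst _.
have zs : z \in s.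
  by have := st z; rewrite !inE eqxx eq_sym (negPf yz).
have yt : y \in t.
  by have := st y; rewrite !inE eqxx (negPf yz).
(* The common last vertex is not [y]: it comes after [y] in the first path. *)
have ylast : y != last z t.
  rewrite -lst; apply: contraTneq us => ->; case: s zs {ps st lst IHs} => //= a s _.
  by rewrite mem_last !andbF.
have exz : e x z by case/andP: pt.
case/splitPr: yt pt ut st ylast {lst} => t1 [|v t2] pt ut st.
  by rewrite last_cat eqxx.
move=> _; pose u := last z t1.
have [euy eyv] : e u y /\ e y v.
  by move: pt; rewrite /= cat_path /= => /and5P[_ _ -> ->].
have : uniq (z :: t1 ++ [:: y, v & t2]) by case/andP: ut.
rewrite -cat_cons cat_uniq /= => /and3P[_ /norP[yt1 /norP[vt1 _]]].
rewrite inE negb_or => /andP[/andP[yv _] _].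
have ut1 : u \in z :: t1 by apply: mem_last.
have us' : u \in s.
  have := st u; rewrite -cat_cons mem_cat ut1 inE.
  by rewrite (negPf (memPn yt1 u ut1)).
have vs' : v \in s.
  by have := st v; rewrite -cat_cons mem_cat !inE eqxx !orbT eq_sym (negPf yv).
have uv : u != v by apply: (memPn vt1).
have [uh | uh] := eqVneq u (head y s).
  by apply: two_chords_cycle ps us zs vs' exz eyv _; rewrite -uh eq_sym.
by apply: two_chords_cycle ps us zs us' exz _ uh; rewrite e_sym.
Qed.

End Cycles.

(** * Edge sets of vertex sequences *)

Section PathEdges.

Variable n : nat.
Implicit Types (x y : 'I_n) (s t : seq 'I_n) (E : {set {set 'I_n}}).

Lemma adj_sym E : symmetric (adj E).
Proof. by move=> x y; rewrite /adj setUC. Qed.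

Lemma path_edges_cons x y s :
  path_edges [:: x, y & s] = [set x; y] |: path_edges (y :: s).
Proof.
apply/setP => A; rewrite !inE; apply/imsetP/orP => /=.
  case=> p; rewrite inE => /orP[/eqP-> ->|ps ->]; first by left.
  by right; apply/imsetP; exists p.
case=> [/eqP->|/imsetP[p ps ->]]; first by exists (x, y); rewrite ?inE ?eqxx.
by exists p; rewrite // inE ps orbT.
Qed.

Lemma path_edges_path E x s : path_edges (x :: s) \subset E -> path (adj E) x s.
Proof.
elim: s x => //= y s IHs x; rewrite path_edges_cons subUset sub1set.
by case/andP=> xyE /IHs->; rewrite andbT.
Qed.

Lemma path_edges_mem s A x : A \in path_edges s -> x \in A -> x \in s.
Proof.
elim: s => [|a s IHs]; first by case/imsetP.
case: s IHs => [_|b s IHs]; first by case/imsetP.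
rewrite path_edges_cons in_setU1 => /orP[/eqP->|/IHs sA /sA xs].
  by rewrite !inE => /orP[]->; rewrite ?orbT.
by rewrite inE xs orbT.
Qed.

(** The first vertex lies on no edge but the first one, so the edge set
    determines the second vertex, and the rest by induction. *)
Lemma path_edges_inj x s t :
  uniq (x :: s) -> uniq (x :: t) -> size s = size t ->
  path_edges (x :: s) = path_edges (x :: t) -> s = t.
Proof.
elim: s x t => [|y s IHs] x [|z t] // us ut [sz].
have first a r : uniq [:: x, a & r] -> [set x; a] \notin path_edges (a :: r).
  by case/andP=> xr _; apply: contra xr => /path_edges_mem; apply; rewrite set21.
rewrite !path_edges_cons => E.
have yz : y = z.
  have : [set x; y] \in [set x; z] |: path_edges (z :: t) by rewrite -E setU11.
  rewrite in_setU1 => /orP[/eqP A|/path_edges_mem/(_ (set21 _ _)) xt].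
    have : y \in [set x; z] by rewrite -A set22.
    rewrite !inE => /orP[] /eqP // yx.
    by move: us; rewrite yx /= inE eqxx.
  by case/andP: ut; rewrite xt.
rewrite -{z}yz in ut E *; congr (_ :: _); apply: (IHs y) sz _.
- by case/andP: us.
- by case/andP: ut.
by rewrite -(setU1K (first _ _ us)) E setU1K // first.
Qed.

Lemma uniq_size_ham_path s : uniq s -> size s = n -> ham_path (path_edges s).
Proof.
by move=> us /eqP sz; apply/existsP; exists (Tuple sz); rewrite us eqxx.
Qed.

Lemma good_cycle_different c E F (C : seq 'I_n) :
  good_cycle (adj (E :|: F)) c C -> cycle_different (nonmultiples c) E F.
Proof.
case=> sC /andP[cC uC] ndC.
have ltC : (size C < n.+1)%N.
  by rewrite ltnS -[X in (_ <= X)%N]card_ord -(card_uniqP uC) max_card.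
apply/existsP; exists (Ordinal ltC); rewrite /nonmultiples ndC /has_cycle sC.
by apply/existsP; exists (in_tuple C); rewrite /ucycleb cC.
Qed.

End PathEdges.

(** * The paths with prescribed endpoints *)

Section EndpointFamily.

Variables (n : nat) (a b : 'I_n).
Hypothesis ab : a != b.

Definition inner : seq 'I_n := enum (~: [set a; b]).

Definition end_path (p : seq 'I_n) : seq 'I_n := a :: rcons p b.

Definition end_family : {set {set {set 'I_n}}} :=
  [set E in [seq path_edges (end_path p) | p <- permutations inner]].

Lemma size_inner : size inner = (n - 2)%N.
Proof. by rewrite -cardE cardsCs setCK cards2 ab card_ord. Qed.

Lemma size_end_path p : perm_eq p inner -> size (end_path p) = n.
Proof.
move=> /perm_size sp; rewrite /= size_rcons sp size_inner.
have := max_card (mem [set a; b]); rewrite cards2 ab card_ord => n2.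
by rewrite -[RHS](subnK n2) addn2.
Qed.

Lemma end_path_uniq p : perm_eq p inner -> uniq (end_path p).
Proof.
move=> pI; rewrite /= mem_rcons inE negb_or ab rcons_uniq.
by rewrite (perm_uniq pI) enum_uniq !(perm_mem pI) !mem_enum !inE !eqxx orbT.
Qed.

Lemma card_end_family : #|end_family| = ((n - 2)`!)%N.
Proof.
rewrite cardsE -size_inner -size_permutations ?enum_uniq //.
rewrite -(size_map (fun p => path_edges (end_path p))).
apply/card_uniqP; rewrite map_inj_in_uniq ?permutations_uniq // => p q.
rewrite !mem_permutations => pI qI /path_edges_inj E.
apply: (@rcons_injl _ b); apply: E; rewrite ?size_rcons.
- exact: end_path_uniq.
- exact: end_path_uniq.
by rewrite (perm_size pI) (perm_size qI).
Qed.

Lemma end_family_different c :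
  (1 < c)%N -> c != 2%N -> c != 4%N ->
  pairwise_cycle_different (nonmultiples c) end_family.
Proof.
move=> c1 c2 c4; apply/andP; split.
  apply/forall_inP => E; rewrite inE => /mapP[p]; rewrite mem_permutations => pI ->.
  by apply: uniq_size_ham_path; [apply: end_path_uniq | apply: size_end_path].
apply/forall_inP => E; rewrite inE => /mapP[p]; rewrite mem_permutations => pI ->.
apply/forall_inP => F; rewrite inE => /mapP[q]; rewrite mem_permutations => qI ->.
apply/implyP => pq; pose U := path_edges (end_path p) :|: path_edges (end_path q).
suff [C /good_cycle_different] : exists C, good_cycle (adj U) c C by [].
apply: (paths_same_ends_cycle (adj_sym U) c1 c2 c4 (x := a)
  (s := rcons p b) (t := rcons q b)).
- by apply: path_edges_path; rewrite subsetUl.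
- by apply: path_edges_path; rewrite subsetUr.
- exact: end_path_uniq.
- exact: end_path_uniq.
- by rewrite -!cats1 perm_cat2r (perm_trans pI) // perm_sym.
- by rewrite !last_rcons.
by apply: contraNneq pq => E'; rewrite /end_path E'.
Qed.

End EndpointFamily.

Lemma fact_div_bin2 n : (2 <= n)%N ->
  n`!%:R / (2 * 'C(n, 2))%:R = (n - 2)`!%:R :> rat.
Proof.
move=> n2; rewrite -(bin_fact n2) mulnA [('C(n, 2) * _)%N]mulnC natrM mulrC mulKf //.
by rewrite pnatr_eq0 muln_eq0 /= -lt0n bin_gt0.
Qed.

Theorem proposition3 (c n : nat) (hc1 : (1 < c)%N) (hc2 : c != 2%N)
    (hc4 : c != 4%N) (hn : (2 <= n)%N) :
  (n`!)%:R / (2 * 'C(n, 2))%:R <= (M n (nonmultiples c))%:R :> rat.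
Proof.
rewrite fact_div_bin2 // ler_nat.
have ab : Ordinal (ltnW hn) != Ordinal hn by [].
rewrite -(card_end_family ab).
by apply: leq_bigmax_cond; apply: end_family_different.
Qed.
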